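(* Let $\mu$ be a positive finite Borel measure on $[0,1)$ such that $\int_0^1\frac{d\mu(t)}{1-t}<\infty$, i.e. $\sum_{n=0}^\infty\mu_n<\infty$. Then $I_\mu:H^\infty\to H^\infty$ is compact and $H_\mu=I_\mu$ on $H^\infty$.
   Context: $\mathbb{D}$ is the open unit disc, $H(\mathbb{D})$ the holomorphic functions on $\mathbb{D}$, $H^\infty$ the Banach space of bounded holomorphic functions on $\mathbb{D}$ with the sup norm. For a positive finite Borel measure $\mu$ on $[0,1)$, $\mu_n=\int_0^1t^n\,d\mu(t)$. For $f(z)=\sum_{n\ge0}a_nz^n\in H(\mathbb{D})$, $H_\mu(f)(z)=\sum_{n=0}^\infty\left(\sum_{k=0}^\infty\mu_{n+k}a_k\right)z^n$ (generalized Hilbert operator) whenever this defines a holomorphic function on $\mathbb{D}$, and $I_\mu(f)(z)=\int_0^1\frac{f(t)}{1-tz}\,d\mu(t)$ whenever this defines a holomorphic function on $\mathbb{D}$. *)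

(* Defs.v *)
(* R : realType, complex numbers R[i] (real-closed),
   used through the regular normed module (R[i])^o so that complex
   differentiability and limits are available. *)
From HB Require Import structures.
From mathcomp Require Import all_boot all_order all_algebra.
From mathcomp Require Import all_classical all_reals all_analysis.
From mathcomp Require Import complex.
Set Implicit Arguments. Unset Strict Implicit. Unset Printing Implicit Defensive.
Import Order.TTheory GRing.Theory Num.Theory.
Import numFieldNormedType.Exports.
Local Open Scope ring_scope.
Local Open Scope classical_set_scope.
Local Open Scope complex_scope.

Notation CC R := ((R[i])^o).

Definition holo_disc (R : realType) (f : CC R -> CC R) : Prop :=
  forall z : CC R, `|z| < 1 -> derivable f z 1.

Definition Hinf (R : realType) (f : CC R -> CC R) : Prop :=
  holo_disc f /\ exists M : R, forall z : CC R, `|z| < 1 -> `|f z| <= M%:C.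

Definition finite_measure_on_01 (R : realType) (mu : {measure set R -> \bar R}) : Prop :=
  (mu setT < +oo)%E /\ mu (~` `[0%R, 1%R[) = 0%E.

Definition moment (R : realType) (mu : {measure set R -> \bar R}) (n : nat) : R :=
  Rintegral mu `[0%R, 1%R[ (fun t => t ^+ n).

Definition cintegrable (R : realType) (mu : {measure set R -> \bar R})
    (g : R -> CC R) : Prop :=
  mu.-integrable `[0%R, 1%R[ (EFin \o (fun t => complex.Re (g t))) /\
  mu.-integrable `[0%R, 1%R[ (EFin \o (fun t => complex.Im (g t))).

Definition cintegral (R : realType) (mu : {measure set R -> \bar R})
    (g : R -> CC R) : CC R :=
  (Rintegral mu `[0%R, 1%R[ (fun t => complex.Re (g t)))%:C +
  'i * (Rintegral mu `[0%R, 1%R[ (fun t => complex.Im (g t)))%:C.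

Definition Imu_integrand (R : realType) (f : CC R -> CC R) (z : CC R) : R -> CC R :=
  fun t => f t%:C / (1 - t%:C * z).

Definition Imu (R : realType) (mu : {measure set R -> \bar R})
    (f : CC R -> CC R) : CC R -> CC R :=
  fun z => cintegral mu (Imu_integrand f z).

(* n-th coefficient of H_mu(f) for f(z) = sum a_k z^k:
   sum_k mu_{n+k} a_k *)
Definition Hmu_coef (R : realType) (mu : {measure set R -> \bar R})
    (a : nat -> CC R) (n : nat) : CC R :=
  lim (series (fun k => ((moment mu (n + k))%:C * a k : CC R)) @ \oo).

Definition compact_op_Hinf (R : realType) (T : (CC R -> CC R) -> (CC R -> CC R)) : Prop :=
  forall f : nat -> CC R -> CC R,
    (forall k, Hinf (f k)) ->
    (exists M : R, forall k (z : CC R), `|z| < 1 -> `|f k z| <= M%:C) ->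
    exists (phi : nat -> nat) (g : CC R -> CC R),
      (forall k, (phi k < phi k.+1)%N) /\ Hinf g /\
      (forall eps : R, 0 < eps ->
         \forall k \near \oo, forall z : CC R, `|z| < 1 ->
            `|T (f (phi k)) z - g z| <= eps%:C).

(* Main.v *)
(* Since [(1 - t)^-1] is [mu]-integrable, the moments are summable and, for [f] bounded by [M],
   expanding the kernel [(1 - tz)^-1] geometrically shows that [Imu mu f] is the power series
   with coefficients [c_n = \int t^n f(t) dmu], where [|c_n| <= 2 M mu_n].
   Power series whose coefficients are dominated by a fixed summable sequence are bounded
   and holomorphic, and coefficientwise convergence along an ultrafilter implies uniform
   convergence on the disc: this gives compactness without Montel's theorem.
   For [Hmu = Imu], averaging over roots of unity bounds the Taylor coefficients of [f]
   by [M], so the remainder of the Taylor series of [f] at [t] after [N] terms is at most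
   [M t^N / (1 - t)], whose integral tends to [0] by dominated convergence. *)
Require Import Defs.
From HB Require Import structures.
From mathcomp Require Import all_boot all_order all_algebra.
From mathcomp Require Import all_classical all_reals all_analysis.
From mathcomp Require Import complex ring lra measurable_realfun.
Set Implicit Arguments. Unset Strict Implicit. Unset Printing Implicit Defensive.
Import Order.TTheory GRing.Theory Num.Theory.
Import numFieldNormedType.Exports.
Local Open Scope ring_scope.
Local Open Scope classical_set_scope.
Local Open Scope complex_scope.

(** * Limits and dominated series of complex numbers *)

Section ComplexLimits.
Context {R : realType}.
Implicit Types (z l : CC R) (e : R).

Lemma normc_ge_Im z : `|complex.Im z|%:C <= `|z|.
Proof.
rewrite -normrN -ReiNIm (le_trans (normc_ge_Re _))// normrM.
by rewrite [X in _ * X]normc_def /= expr0n expr1n add0r sqrtr1 mulr1.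
Qed.

Lemma normc_le_ReIm z : `|z| <= `|complex.Re z|%:C + `|complex.Im z|%:C.
Proof.
rewrite [z in X in X <= _]complexE (le_trans (ler_normD _ _))// normrM.
by rewrite !normc_def /= !expr0n !expr1n add0r !addr0 sqrtr1 mul1r !sqrtr_sqr.
Qed.

Lemma normcR (x : R) : `|x%:C : CC R| = `|x|%:C.
Proof. by rewrite normc_def /= expr0n addr0 sqrtr_sqr. Qed.

(** The order of [R[i]] compares only numbers with equal imaginary parts, so positive elements are
    real. Hence every epsilon in a complex limit can be taken in [R]. *)
Lemma gt0_complexE (x : CC R) : 0 < x -> exists2 e, 0 < e & x = e%:C.
Proof.
case: x => a b; rewrite ltcE /= => /andP[/eqP -> a0].
by exists a.
Qed.

Lemma ge0_complexE (x : CC R) : 0 <= x -> exists2 e, 0 <= e & x = e%:C.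
Proof.
case: x => a b; rewrite lecE /= => /andP[/eqP -> a0].
by exists a.
Qed.

Lemma cvgC_le {T : Type} (F : set_system T) {FF : Filter F} (u : T -> CC R) l :
  (forall e, 0 < e -> \forall x \near F, `|l - u x| <= e%:C) -> u @ F --> l.
Proof.
move=> H; apply/cvgrPdist_le => x /gt0_complexE[e e0 ->]; exact: H.
Qed.

Lemma cvgC_near {T : Type} (F : set_system T) {FF : Filter F} (u : T -> CC R) l e :
  u @ F --> l -> 0 < e -> \forall x \near F, `|l - u x| <= e%:C.
Proof.
move=> /cvgrPdist_le H e0; apply: H; by rewrite ltcR.
Qed.

Lemma cvgC_ReIm {T : Type} (F : set_system T) {FF : Filter F} (u : T -> CC R) l :
  complex.Re (u x) @[x --> F] --> complex.Re l ->
  complex.Im (u x) @[x --> F] --> complex.Im l -> u @ F --> l.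
Proof.
move=> /cvgrPdist_le hr /cvgrPdist_le hi; apply: cvgC_le => e e0.
have e2 : 0 < e / 2 by rewrite divr_gt0.
near=> x; rewrite (le_trans (normc_le_ReIm _))// -raddfD/= lecR.
rewrite [leRHS]splitr lerD//.
- by rewrite raddfB /=; near: x; exact: hr.
- by rewrite raddfB /=; near: x; exact: hi.
Unshelve. all: by end_near. Qed.

Lemma cvg_Re {T : Type} (F : set_system T) {FF : Filter F} (u : T -> CC R) l :
  u @ F --> l -> complex.Re (u x) @[x --> F] --> complex.Re l.
Proof.
move=> ul; apply/cvgrPdist_le => e e0; near=> x.
rewrite -lecR -raddfB (le_trans (normc_ge_Re _))//; near: x.
exact: cvgC_near.
Unshelve. all: by end_near. Qed.

Lemma cvg_Im {T : Type} (F : set_system T) {FF : Filter F} (u : T -> CC R) l :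
  u @ F --> l -> complex.Im (u x) @[x --> F] --> complex.Im l.
Proof.
move=> ul; apply/cvgrPdist_le => e e0; near=> x.
rewrite -lecR -raddfB (le_trans (normc_ge_Im _))//; near: x.
exact: cvgC_near.
Unshelve. all: by end_near. Qed.

Lemma cvg_dist_le {T : Type} (F : set_system T) {FF : ProperFilter F}
    (u : T -> CC R) l z (m : R) :
  u @ F --> l -> (\forall x \near F, `|z - u x| <= m%:C) -> `|z - l| <= m%:C.
Proof.
move=> ul um.
have [d d0 de] := ge0_complexE (normr_ge0 (z - l)).
rewrite de lecR; apply/ler_addgt0Pr => e e0.
rewrite -lecR -de raddfD/=.
have [x [h1 h2]] := @filter_ex _ _ FF _ (filterI um (cvgC_near ul e0)).
rewrite (_ : z - l = (z - u x) - (l - u x)); last by rewrite opprB addrA subrK.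
by rewrite (le_trans (ler_normB _ _))// lerD.
Qed.

Lemma cvg_norm_le {T : Type} (F : set_system T) {FF : ProperFilter F}
    (u : T -> CC R) l (m : R) :
  u @ F --> l -> (\forall x \near F, `|u x| <= m%:C) -> `|l| <= m%:C.
Proof.
move=> ul um; rewrite -normrN -sub0r; apply: cvg_dist_le ul _.
by apply: filterS um => x; rewrite sub0r normrN.
Qed.

Lemma norm_series_le (c : nat -> CC R) (b : nat -> R) (m n : nat) :
  (forall n, `|c n| <= (b n)%:C) -> (m <= n)%N ->
  `|series c n - series c m| <= (series b n - series b m)%:C.
Proof.
move=> cb mn; rewrite !sub_series_geq//.
rewrite (le_trans (ler_norm_sum _ _ _))// raddf_sum /=.
by apply: ler_sum.
Qed.

(** The real and imaginary parts are each dominated by [b], so each converges absolutely by the real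
    comparison test. *)
Lemma is_cvg_dominated_series (c : nat -> CC R) (b : nat -> R) :
  (forall n, `|c n| <= (b n)%:C) -> cvgn (series b) -> cvgn (series c).
Proof.
move=> cb bcvg.
have part (p : CC R -> R) : (forall z, `|p z|%:C <= `|z|) ->
    cvgn (series (fun n => p (c n))).
  move=> pz; apply: normed_cvg; apply: series_le_cvg bcvg.
  - by move=> n; rewrite normr_ge0.
  - by move=> n; rewrite -lecR (le_trans (normr_ge0 _) (cb n)).
  - by move=> n; rewrite -lecR (le_trans (pz _)).
have /cvg_ex[x hx] := part _ (@normc_ge_Re _).
have /cvg_ex[y hy] := part _ normc_ge_Im.
apply/cvg_ex; exists (x +i* y); apply: cvgC_ReIm => /=.
- rewrite (_ : (fun _ => _) = series (fun n => complex.Re (c n)))//.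
  by apply/funext => n; rewrite /series/= raddf_sum.
- rewrite (_ : (fun _ => _) = series (fun n => complex.Im (c n)))//.
  by apply/funext => n; rewrite /series/= raddf_sum.
Qed.

(** The error depends on the majorant [b] alone. This is the source of all later uniformity, in the
    point of the disc and in the index of a sequence of functions. *)
Lemma dominated_series_tail (c : nat -> CC R) (b : nat -> R) l (n : nat) :
  (forall n, `|c n| <= (b n)%:C) -> cvgn (series b) -> series c @ \oo --> l ->
  `|series c n - l| <= (limn (series b) - series b n)%:C.
Proof.
move=> cb bcvg cl; apply: cvg_dist_le cl _.
near=> m.
rewrite distrC (le_trans (norm_series_le cb _))//; first by near: m; exact: nbhs_infty_ge.
rewrite lecR lerB// nondecreasing_cvgn_le//.
apply: nondecreasing_series => k _ _; rewrite -lecR.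
exact: le_trans (normr_ge0 _) (cb k).
Unshelve. all: by end_near. Qed.

End ComplexLimits.

(** * Holomorphy from second divided differences *)

Section PowerSeries.

Lemma norm_expB_le (C : numFieldType) (r w w' : C) (n : nat) :
  r < 1 -> `|w| <= r -> `|w'| <= r ->
  `|w ^+ n - w' ^+ n| <= (1 - r)^-1 * `|w - w'|.
Proof.
move=> r1 wr w'r; have r0 : 0 <= r := le_trans (normr_ge0 _) wr.
have B0 : 0 < 1 - r by rewrite subr_gt0.
elim: n => [|n IH]; first by rewrite !expr0 subrr normr0 mulr_ge0// invr_ge0 ltW.
(* The constant [(1 - r)^-1] solves [x = r * x + 1], so this recursion preserves it and the bound
   does not depend on [n]. *)
rewrite (_ : _ - _ = w' * (w ^+ n - w' ^+ n) + (w - w') * w ^+ n); last by rewrite !exprS; ring.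
rewrite (le_trans (ler_normD _ _))// !normrM normrX.
rewrite (_ : (1 - r)^-1 * _ = r * ((1 - r)^-1 * `|w - w'|) + `|w - w'| * 1); last first.
  by field; rewrite gt_eqF.
rewrite lerD// ?ler_pM// exprn_ile1//.
by rewrite (le_trans wr)// ltW.
Qed.

(* The left-hand side is [(w - z) (w' - z) (w - w')] times the second divided
   difference of [x ^+ n] at [z, w, w']. *)
Lemma norm_second_difference_expr (C : numFieldType) (r z w w' : C) (n : nat) :
  r < 1 -> `|z| <= r -> `|w| <= r -> `|w'| <= r ->
  `|(w ^+ n - z ^+ n) * (w' - z) - (w' ^+ n - z ^+ n) * (w - z)|
    <= (1 - r)^-1 ^+ 2 * (`|w - z| * `|w' - z| * `|w - w'|).
Proof.
move=> r1 zr wr w'r; have r0 : 0 <= r := le_trans (normr_ge0 _) wr.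
have B0 : 0 < 1 - r by rewrite subr_gt0.
set d := (_ * _ * _); have d0 : 0 <= d by rewrite !mulr_ge0.
elim: n => [|n IH].
  by rewrite !expr0 subrr !mul0r subrr normr0 mulr_ge0// exprn_ge0// invr_ge0 ltW.
(* The same device one order higher: [(1 - r)^-1 ^+ 2] solves [x = r * x + (1 - r)^-1], the last
   term coming from [norm_expB_le]. *)
rewrite (_ : _ - _ =
  z * ((w ^+ n - z ^+ n) * (w' - z) - (w' ^+ n - z ^+ n) * (w - z)) +
  (w - z) * (w' - z) * (w ^+ n - w' ^+ n)); last by rewrite !exprS; ring.
rewrite (le_trans (ler_normD _ _))// !normrM.
rewrite (_ : (1 - r)^-1 ^+ 2 * _ =
  r * ((1 - r)^-1 ^+ 2 * d) + `|w - z| * `|w' - z| * ((1 - r)^-1 * `|w - w'|)); last first.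
  by rewrite /d; field; rewrite gt_eqF.
by rewrite lerD// ?ler_pM// ?mulr_ge0// norm_expB_le.
Qed.

Context {R : realType}.
Implicit Types (z w : CC R).

(** Dividing the hypothesis by the increments shows that the difference quotient at [z] is Lipschitz
    on a punctured disc. It is therefore Cauchy at 0 and converges by completeness, without any
    candidate for the derivative. *)
Lemma derivable_second_difference (F : CC R -> CC R) z (r K : R) :
  0 < r ->
  (forall w w', `|w - z| <= r%:C -> `|w' - z| <= r%:C ->
     `|(F w - F z) * (w' - z) - (F w' - F z) * (w - z)|
       <= K%:C * (`|w - z| * `|w' - z| * `|w - w'|)) ->
  derivable F z 1.
Proof.
move=> r0 HF; rewrite /derivable.
set q := fun h : CC R => _.
(* Replacing [K] by [|K| + 1] gives a positive Lipschitz constant, by which one can divide. *)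
have K0 : 0 < `|K| + 1 by rewrite ltr_wpDl.
have qL h h' : h != 0 -> h' != 0 -> `|h| <= r%:C -> `|h'| <= r%:C ->
    `|q h - q h'| <= (`|K| + 1)%:C * `|h - h'|.
  move=> h0 h'0 hr h'r.
  have := HF (h + z) (h' + z); rewrite !addrK => /(_ hr h'r).
  rewrite (_ : h + z - (h' + z) = h - h'); last by ring.
  have -> : q h - q h' = ((F (h + z) - F z) * h' - (F (h' + z) - F z) * h) / (h * h').
    rewrite /q /= /GRing.scale /= !mulr1.
    by field; apply/andP.
  rewrite normrM normfV normrM ler_pdivrMr ?mulr_gt0 ?normr_gt0// => /le_trans; apply.
  rewrite (_ : _ * (`|h| * `|h'|) = (`|K| + 1)%:C * (`|h| * `|h'| * `|h - h'|)); last by ring.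
  rewrite ler_wpM2r ?mulr_ge0// lecR.
  by rewrite (le_trans (ler_norm _))// lerDl.
have part (p : CC R -> R) : (forall a b, p (a - b) = p a - p b) ->
   (forall z, `|p z|%:C <= `|z|) -> cvg (p (q h) @[h --> 0^']).
  move=> pB pz; apply/cauchy_cvgP/cauchy_ballP => e e0.
  (* Two increments of size at most [d] differ by at most [d + d], and
     [(|K| + 1) * (d + d) <= e / 2 < e]. *)
  pose d := Num.min r (e / 2 / (`|K| + 1) / 2).
  have d0 : 0 < d by rewrite lt_min r0/= !divr_gt0.
  have Hd : \forall h \near (0 : CC R)^', h != 0 /\ `|h| <= d%:C.
    near=> h; split; first by near: h; exact: nbhs_dnbhs_neq.
    near: h; apply: dnbhs0_le; by rewrite ltcR.
  pose A := [set x : R | exists2 h : CC R, h != 0 /\ `|h| <= d%:C & x = p (q h)].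
  have AF : nbhs (p (q h) @[h --> 0^']) A.
    by apply: filterS Hd => h Hh; exists h.
  exists (A, A); first by split.
  move=> [x y] [/= [h [h0 hd] ->] [h' [h'0 h'd] ->]].
  rewrite /ball /= -ltcR -pB (le_lt_trans (pz _))//.
  have hr (k : CC R) : `|k| <= d%:C -> `|k| <= r%:C.
    by move=> /le_trans; apply; rewrite lecR ge_min lexx.
  rewrite (le_lt_trans (qL _ _ _ _ (hr _ hd) (hr _ h'd)))//.
  rewrite (@le_lt_trans _ _ ((`|K| + 1) * (d + d))%:C)//.
    rewrite rmorphM/= ler_wpM2l//; first by rewrite ler0c ltW.
    by rewrite (le_trans (ler_normB _ _))// raddfD lerD.
  rewrite ltcR (@le_lt_trans _ _ (e / 2))//; last by lra.
  have dle : d <= e / 2 / (`|K| + 1) / 2 by rewrite ge_min lexx orbT.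
  have := ler_wpM2l (ltW K0) (lerD dle dle).
  move/le_trans; apply.
  rewrite le_eqVlt; apply/orP; left; apply/eqP; field.
  by rewrite gt_eqF.
have /cvg_ex[x hx] := part _ (fun a b => raddfB _ _ _) (@normc_ge_Re _).
have /cvg_ex[y hy] := part _ (fun a b => raddfB _ _ _) normc_ge_Im.
by apply/cvg_ex; exists (x +i* y); exact: cvgC_ReIm.
Unshelve. all: by end_near. Qed.

End PowerSeries.

(** * Power series with dominated coefficients *)

Section PowerSeriesSum.
Context {R : realType}.
Implicit Types (c l : nat -> CC R) (b : nat -> R) (F : CC R -> CC R) (z : CC R).

Lemma norm_power_le c b z n :
  (forall n, `|c n| <= (b n)%:C) -> `|z| < 1 -> `|c n * z ^+ n| <= (b n)%:C.
Proof.
move=> cb z1; rewrite normrM normrX (le_trans _ (cb n))// ler_piMr//.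
by rewrite exprn_ile1// ltW.
Qed.

(** The second-difference estimate is linear in the function and uniform over the monomials. It
    passes to partial sums with constant [(1 - (d + r))^-1 ^+ 2] times the sum of [b], and then to
    the limit. *)
Lemma power_series_Hinf c b F :
  (forall n, `|c n| <= (b n)%:C) -> cvgn (series b) ->
  (forall z, `|z| < 1 -> series (fun n => c n * z ^+ n : CC R) @ \oo --> F z) ->
  Hinf F.
Proof.
move=> cb bcvg cF.
have tail z n (z1 : `|z| < 1) :=
  @dominated_series_tail _ _ _ _ n (fun n => norm_power_le n cb z1) bcvg (cF z z1).
have b0 n : 0 <= b n by rewrite -lecR (le_trans (normr_ge0 _) (cb n)).
have bound n : series b n <= limn (series b).
  by apply: nondecreasing_cvgn_le => //; exact: nondecreasing_series.
split; last first.
  exists (limn (series b)) => z z1.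
  (* The tail after the empty partial sum is the whole of [F z]. *)
  have := tail z 0%N z1; rewrite /series/= !big_geq// sub0r normrN subr0.
  exact.
move=> z z1.
have [d d0 de] := ge0_complexE (normr_ge0 z).
have d1 : d < 1 by move: z1; rewrite de ltcR.
(* Half the distance from [z] to the unit circle: the disc of radius [r] around [z] stays inside
   radius [d + r < 1]. *)
pose r := (1 - d) / 2.
have r0 : 0 < r by rewrite /r divr_gt0// subr_gt0.
have rd : d + r < 1 by rewrite /r; lra.
have rdC : (d + r)%:C < 1 :> CC R by rewrite -[1]/(1%:C) ltcR.
have zr : `|z| <= (d + r)%:C by rewrite de lecR lerDl ltW.
apply: (@derivable_second_difference _ _ _ r ((1 - (d + r))^-1 ^+ 2 * limn (series b))) => //.
move=> w w' wz w'z.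
have wr w0 : `|w0 - z| <= r%:C -> `|w0| <= (d + r)%:C.
  move=> H; rewrite -(subrK z w0) (le_trans (ler_normD _ _))// addrC raddfD/= lerD//.
  by rewrite de.
have w1 := le_lt_trans (wr _ wz) rdC.
have w'1 := le_lt_trans (wr _ w'z) rdC.
pose p n (x : CC R) := series (fun n => c n * x ^+ n : CC R) n.
have lim : (fun n => (p n w - p n z) * (w' - z) - (p n w' - p n z) * (w - z)) @ \oo -->
  (F w - F z) * (w' - z) - (F w' - F z) * (w - z).
  apply: cvgB; apply: cvgMl; apply: cvgB; exact: cF.
have [m m0 me] := ge0_complexE
  (mulr_ge0 (mulr_ge0 (normr_ge0 (w - z)) (normr_ge0 (w' - z))) (normr_ge0 (w - w'))).
rewrite me -rmorphM/=; apply: cvg_norm_le lim _.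
apply: nearW => n; rewrite rmorphM/= -me.
have -> : (p n w - p n z) * (w' - z) - (p n w' - p n z) * (w - z) =
    \sum_(0 <= k < n) c k * ((w ^+ k - z ^+ k) * (w' - z) - (w' ^+ k - z ^+ k) * (w - z)).
  rewrite /p /series/= -!sumrB !mulr_suml -sumrB.
  by apply: eq_bigr => k _; ring.
rewrite (le_trans (ler_norm_sum _ _ _))//.
rewrite (@le_trans _ _ (\sum_(0 <= k < n) (b k)%:C * ((1 - (d + r)%:C)^-1 ^+ 2 *
   (`|w - z| * `|w' - z| * `|w - w'|))))//.
  apply: ler_sum => k _; rewrite normrM ler_pM//.
  by apply: norm_second_difference_expr => //; exact: wr.
rewrite -mulr_suml -raddf_sum/= mulrA ler_wpM2r ?mulr_ge0//.
rewrite -[1 in X in X <= _]/(1%:C) -raddfB/= -fmorphV/= -rmorphXn/= -rmorphM/= lecR mulrC.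
apply: ler_wpM2l; last exact: bound.
by rewrite exprn_ge0// invr_ge0 subr_ge0 ltW.
Qed.

(** Compactness of the segment yields a cluster point, and a cluster point of an ultrafilter is a
    limit. *)
Lemma ultra_bounded_cvg (T : Type) (U : set_system T) (x : T -> R) (B : R) :
  UltraFilter U -> (forall k, `|x k| <= B) -> exists l : R, x @ U --> l.
Proof.
move=> UU xB; have UP := ultra_proper.
have : (x @ U) `[- B, B].
  suff : U (x @^-1` `[- B, B]) by [].
  by apply: filterE => k /=; rewrite in_itv/= -ler_norml; exact: xB.
move=> /(@segment_compact _ _ _ (x @ U) _)[l [_ cl]]; exists l => A nA.
have [//|nA'] := in_ultra_setVsetC (x @^-1` A) UU.
by have [y []] := cl (~` A) A nA' nA.
Qed.

Lemma ultra_bounded_cvgC (T : Type) (U : set_system T) (x : T -> CC R) (B : R) :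
  UltraFilter U -> (forall k, `|x k| <= B%:C) -> exists l : CC R, x @ U --> l.
Proof.
move=> UU xB; have UP := ultra_proper.
have [k|a ha] := @ultra_bounded_cvg _ U (fun k => complex.Re (x k)) B UU.
  by rewrite -lecR (le_trans (normc_ge_Re _)).
have [k|a' ha'] := @ultra_bounded_cvg _ U (fun k => complex.Im (x k)) B UU.
  by rewrite -lecR (le_trans (normc_ge_Im _)).
by exists (a +i* a'); exact: cvgC_ReIm.
Qed.

(** An ultrafilter finer than [\oo] makes all coefficient sequences converge at once, in place of a
    diagonal extraction. The limits inherit the majorant [b], so [g] is their power series. *)
Lemma power_series_frequently_close (c : nat -> nat -> CC R) b
    (F : nat -> CC R -> CC R) :
  (forall k n, `|c k n| <= (b n)%:C) -> cvgn (series b) ->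
  (forall k z, `|z| < 1 ->
     series (fun n => c k n * z ^+ n : CC R) @ \oo --> F k z) ->
  exists2 g : CC R -> CC R, Hinf g &
    forall (e : R) N, 0 < e ->
      exists2 k, (N <= k)%N & forall z, `|z| < 1 -> `|F k z - g z| <= e%:C.
Proof.
move=> cb bcvg cF.
have [U [UU NU]] := ultraFilterLemma (_ : ProperFilter (\oo : set_system nat)).
have UP := @ultra_proper _ _ UU.
have /choice[l hl] : forall n, exists y : CC R, c ^~ n @ U --> y.
  move=> n; exact: (ultra_bounded_cvgC UU (fun k => cb k n)).
have lb n : `|l n| <= (b n)%:C.
  by apply: cvg_norm_le (hl n) _; exact: nearW.
have gcvg z (z1 : `|z| < 1) :=
  is_cvg_dominated_series (fun n => norm_power_le n lb z1) bcvg.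
exists (fun z => limn (series (fun n => l n * z ^+ n : CC R))).
  exact: power_series_Hinf lb bcvg gcvg.
move=> e N e0.
have e4 : 0 < e / 4 by rewrite divr_gt0.
have [m _ /(_ m (leqnn m)) hm] : \forall m \near \oo, `|limn (series b) - series b m| <= e / 4.
  by move/cvgrPdist_le : bcvg; exact.
(* Budget: [e / 4] for each of the two tails beyond [m], and [e / 2] for the first [m] coefficients
   together. Dividing by [m.+1] also covers [m = 0]. *)
have : \forall k \near U, (N <= k)%N /\
    forall i : 'I_m, `|l i - c k i| <= (e / 2 / m.+1%:R)%:C.
  apply: filterI; first by apply: NU; exact: nbhs_infty_ge.
  apply: filter_forall => i; apply: cvgC_near (hl i) _.
  by rewrite !divr_gt0.
move=> /(@filter_ex _ _ _)[k [Nk hk]]; exists k => // z z1.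
set g := limn _.
have t1 := dominated_series_tail m (fun n => norm_power_le n (cb k) z1) bcvg (cF k z z1).
have t2 := dominated_series_tail m (fun n => norm_power_le n lb z1) bcvg (gcvg z z1).
have hm' : limn (series b) - series b m <= e / 4 := le_trans (ler_norm _) hm.
set S1 := series _ m in t1; set S2 := series _ m in t2.
have t3 : `|S1 - S2| <= (e / 2)%:C.
  rewrite /S1 /S2 /series/= -sumrB big_mkord (le_trans (ler_norm_sum _ _ _))//.
  rewrite (@le_trans _ _ (\sum_(i < m) (e / 2 / m.+1%:R)%:C))//.
    apply: ler_sum => i _; rewrite -mulrBl normrM normrX distrC.
    rewrite (le_trans _ (hk i))// ler_piMr// exprn_ile1//.
    exact: ltW.
  rewrite -raddf_sum/= lecR sumr_const card_ord -[leLHS]mulr_natr -mulrA ler_piMr//.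
    by rewrite divr_ge0// ltW.
  by rewrite mulrC ler_pdivrMr// mul1r ler_nat.
have -> : F k z - g = - (S1 - F k z) + (S1 - S2) + (S2 - g) by ring.
rewrite (le_trans (ler_normD _ _))//.
rewrite (_ : e%:C = (e / 4)%:C + (e / 2)%:C + (e / 4)%:C); last first.
  by rewrite -!raddfD/=; congr (_%:C); field.
rewrite lerD ?(le_trans t2) ?lecR// (le_trans (ler_normD _ _))// lerD//.
by rewrite normrN (le_trans t1) ?lecR.
Qed.

Lemma power_series_uniform_subsequence (c : nat -> nat -> CC R) b
    (F : nat -> CC R -> CC R) :
  (forall k n, `|c k n| <= (b n)%:C) -> cvgn (series b) ->
  (forall k z, `|z| < 1 ->
     series (fun n => c k n * z ^+ n : CC R) @ \oo --> F k z) ->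
  exists (phi : nat -> nat) (g : CC R -> CC R),
    (forall k, (phi k < phi k.+1)%N) /\ Hinf g /\
    (forall e : R, 0 < e -> \forall k \near \oo, forall z : CC R, `|z| < 1 ->
       `|F (phi k) z - g z| <= e%:C).
Proof.
move=> cb bcvg cF.
have [g gH close] := power_series_frequently_close cb bcvg cF.
(* A pair records the stage and the chosen index; the stage [j] fixes the tolerance
   [1 / (j + 1)]. *)
have next (p : nat * nat) : {q : nat * nat | [/\ q.1 = p.1.+1, (p.2 < q.2)%N &
    forall z, `|z| < 1 -> `|F q.2 z - g z| <= (q.1.+1%:R^-1)%:C]}.
  apply: cid; have [//|k pk hk] := close (p.1.+2%:R^-1) p.2.+1.
  by exists (p.1.+1, k).
have [s [s0 hs]] := dependent_choice next (0%N, 0%N).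
have s1 k : (s k).1 = k by elim: k => [|k IH]; [rewrite s0|have [-> _ _] := hs k; rewrite IH].
(* The shift drops the initial pair, for which no estimate is known. *)
exists (fun k => (s k.+1).2), g; split; first by move=> k; have [] := hs k.+1.
split=> // e e0.
have [N _ hN] := near_infty_natSinv_lt (PosNum e0).
exists N => // k Nk z z1; have [_ _ /(_ z z1)/le_trans] := hs k; apply.
rewrite lecR s1 ltW// hN//=; exact: (leq_trans Nk).
Qed.

End PowerSeriesSum.

(** * Integrals of complex-valued functions on [0, 1) *)

Section Integrals.
Context {R : realType}.
Local Notation D := (`[0%R, 1%R[%classic : set R).
Implicit Types (g h : R -> CC R) (z : CC R) (G : R -> R).

Definition cmeasurable g :=
  measurable_fun D (fun t => complex.Re (g t)) /\
  measurable_fun D (fun t => complex.Im (g t)).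

Lemma measurable_D : measurable D. Proof. exact: measurable_itv. Qed.

(** Continuity gives measurability on an open set, which [D] is not. It is therefore assumed on
    []-1, 1[] and the result is restricted to [D]. *)
Lemma cmeasurable_continuous g :
  (forall t : R, `|t| < 1 -> {for t, continuous g}) -> cmeasurable g.
Proof.
move=> gC.
have sub : D `<=` `]-1, 1[.
  by move=> t /=; rewrite !in_itv/= => /andP[t0 ->]; rewrite andbT (lt_le_trans _ t0).
have main (p : CC R -> R) : (forall t : R, `|t| < 1 -> {for t, continuous (p \o g)}) ->
    measurable_fun D (p \o g).
  move=> pC; apply: (measurable_funS _ sub) => //.
  apply: open_continuous_measurable_fun; first exact: interval_open.
  by move=> t; rewrite inE/= in_itv/= -ltr_norml => /pC.
split; apply: main => t /gC tC.
- exact: cvg_Re.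
- exact: cvg_Im.
Qed.

Lemma cmeasurableM g h :
  cmeasurable g -> cmeasurable h -> cmeasurable (fun t => g t * h t).
Proof.
move=> [g1 g2] [h1 h2]; split.
- rewrite [X in measurable_fun _ X](_ : _ =
     ((fun t => complex.Re (g t)) \* (fun t => complex.Re (h t))) \-
     ((fun t => complex.Im (g t)) \* (fun t => complex.Im (h t)))).
    by apply: measurable_funB; exact: measurable_funM.
  by apply/funext => t /=; case: (g t) => a b; case: (h t).
- rewrite [X in measurable_fun _ X](_ : _ =
     ((fun t => complex.Re (g t)) \* (fun t => complex.Im (h t))) \+
     ((fun t => complex.Im (g t)) \* (fun t => complex.Re (h t)))).
    by apply: measurable_funD; exact: measurable_funM.
  by apply/funext => t /=; case: (g t) => a b; case: (h t).
Qed.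

Lemma continuous_real_complex : continuous (fun t : R => t%:C : CC R).
Proof. by move=> t; apply: cvgC_ReIm => /=; [exact: cvg_id|exact: cvg_cst]. Qed.

Lemma continuous_geometric_kernel z (t : R) :
  `|z| <= 1 -> `|t| < 1 -> {for t, continuous (fun s : R => (1 - s%:C * z)^-1 : CC R)}.
Proof.
move=> z1 t1; apply: cvgV.
  rewrite subr_eq0; apply/eqP => /(congr1 Num.norm); rewrite normr1 normrM normcR => E.
  have : 1 < 1 :> CC R.
    rewrite {1}E (le_lt_trans (ler_wpM2l _ z1))// ?ler0c// mulr1.
    by rewrite -[1]/(1%:C) ltcR.
  by rewrite ltxx.
apply: cvgB; first exact: cvg_cst.
by apply: cvgMl; exact: continuous_real_complex.
Qed.

Lemma cmeasurable_real G : measurable_fun D G -> cmeasurable (fun t => (G t)%:C).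
Proof. by split => //=; exact: measurable_cst. Qed.

Lemma cmeasurable_kernel z : `|z| <= 1 ->
  cmeasurable (fun t : R => (1 - t%:C * z)^-1 : CC R).
Proof.
by move=> z1; apply: cmeasurable_continuous => t; exact: continuous_geometric_kernel.
Qed.

Lemma measurable_inv1B : measurable_fun D (fun t : R => (1 - t)^-1).
Proof.
(* The boundary point [z = 1] of the complex kernel gives the real one. *)
have [|H _] := @cmeasurable_kernel 1; first by rewrite normr1.
apply: eq_measurable_fun H => t _.
suff ->  : (1 - t%:C * 1)^-1 = ((1 - t)^-1)%:C :> CC R by [].
by rewrite mulr1 fmorphV rmorphB rmorph1.
Qed.

Context {mu : {measure set R -> \bar R}}.
Local Notation Dintegrable G := (mu.-integrable D (EFin \o G)).

Lemma cintegrable_dominated g G :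
  cmeasurable g -> Dintegrable G -> (forall t, D t -> `|g t| <= (G t)%:C) ->
  cintegrable mu g.
Proof.
move=> [g1 g2] iG gG.
have main (p : CC R -> R) : (forall z, `|p z|%:C <= `|z|) -> measurable_fun D (p \o g) ->
    Dintegrable (p \o g).
  move=> pz mp; apply: (le_integrable measurable_D _ _ iG).
    exact/measurable_EFinP.
  move=> t Dt; rewrite /= lee_fin -lecR (le_trans (pz _))// (le_trans (gG t Dt))//.
  by rewrite lecR ler_norm.
split; apply: main => //.
- exact: normc_ge_Re.
- exact: normc_ge_Im.
Qed.

(** The factor 2 comes from bounding the real and imaginary parts separately by the integral of
    [G]. *)
Lemma norm_cintegral_le g G :
  cintegrable mu g -> Dintegrable G -> (forall t, D t -> `|g t| <= (G t)%:C) ->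
  `|cintegral mu g| <= (2 * Rintegral mu D G)%:C.
Proof.
move=> [g1 g2] iG gG.
have main (p : CC R -> R) : (forall z, `|p z|%:C <= `|z|) -> Dintegrable (p \o g) ->
    `|Rintegral mu D (p \o g)| <= Rintegral mu D G.
  move=> pz ip; rewrite (le_trans (le_normr_Rintegral measurable_D ip))//.
  apply: le_Rintegral => //.
    exact: (integrable_abse ip).
  by move=> t Dt; rewrite -lecR (le_trans (pz _))// gG.
rewrite /cintegral (le_trans (ler_normD _ _))// normrM normcR.
rewrite [`|'i|]normc_def/= expr0n expr1n add0r sqrtr1 mul1r normcR.
rewrite mulr2n mulrDl mul1r raddfD lerD// lecR.
- exact: main (@normc_ge_Re _) g1.
- exact: main normc_ge_Im g2.
Qed.

Lemma cintegralD g h : cintegrable mu g -> cintegrable mu h ->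
  cintegrable mu (fun t => g t + h t) /\
  cintegral mu (fun t => g t + h t) = cintegral mu g + cintegral mu h.
Proof.
move=> [g1 g2] [h1 h2].
have E1 : (fun t => complex.Re (g t + h t)) = (fun t => complex.Re (g t) + complex.Re (h t)).
  by apply/funext => t; rewrite raddfD.
have E2 : (fun t => complex.Im (g t + h t)) = (fun t => complex.Im (g t) + complex.Im (h t)).
  by apply/funext => t; rewrite raddfD.
split.
  split; rewrite ?E1 ?E2.
  - exact: (integrableD measurable_D g1 h1).
  - exact: (integrableD measurable_D g2 h2).
rewrite /cintegral E1 E2 !RintegralD//; try exact: measurable_D.
by rewrite !raddfD/= mulrDr addrACA.
Qed.

Lemma cintegralZ z g : cintegrable mu g ->
  cintegrable mu (fun t => z * g t) /\
  cintegral mu (fun t => z * g t) = z * cintegral mu g.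
Proof.
case: z => a b [g1 g2].
have iZ (k : R) G : Dintegrable G -> Dintegrable (fun t => k * G t).
  by move=> iG; exact: (integrableZl measurable_D k iG).
have E1 : (fun t => complex.Re ((a +i* b) * g t)) =
    (fun t => a * complex.Re (g t) - b * complex.Im (g t)).
  by apply/funext => t; case: (g t).
have E2 : (fun t => complex.Im ((a +i* b) * g t)) =
    (fun t => a * complex.Im (g t) + b * complex.Re (g t)).
  by apply/funext => t; case: (g t).
split.
  split; rewrite ?E1 ?E2.
  - exact: (integrableB measurable_D (iZ a _ g1) (iZ b _ g2)).
  - exact: (integrableD measurable_D (iZ a _ g2) (iZ b _ g1)).
rewrite /cintegral E1 E2 RintegralB ?RintegralD//; try exact: measurable_D; try exact: iZ.
rewrite !RintegralZl//; try exact: measurable_D.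
by apply/eqP; rewrite eq_complex/=; apply/andP; split; apply/eqP; ring.
Qed.

Lemma eq_cintegral g h : (forall t, D t -> g t = h t) -> cintegral mu g = cintegral mu h.
Proof.
move=> gh; congr (_%:C + 'i * _%:C); apply: eq_Rintegral => t; rewrite inE => /gh -> //.
Qed.

Lemma cintegral_real G : cintegral mu (fun t => (G t)%:C) = (Rintegral mu D G)%:C.
Proof.
rewrite /cintegral /= Rintegral_cst; last exact: measurable_D.
by rewrite mul0r mulr0 addr0.
Qed.

Lemma cintegral_series (h : nat -> R -> CC R) n : (forall k, cintegrable mu (h k)) ->
  cintegrable mu (fun t => \sum_(0 <= k < n) h k t) /\
  cintegral mu (fun t => \sum_(0 <= k < n) h k t) = \sum_(0 <= k < n) cintegral mu (h k).
Proof.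
move=> hi; elim: n => [|n [IH1 IH2]].
  (* The empty sum is written as a zero multiple of [h 0], so that [cintegralZ] covers it. *)
  rewrite (_ : (fun _ => _) = (fun t => 0 * h 0%N t)); last first.
    by apply/funext => t; rewrite big_geq// mul0r.
  by rewrite big_geq//; have [? ->] := cintegralZ 0 (hi 0%N); rewrite mul0r.
rewrite (_ : (fun _ => _) = (fun t => \sum_(0 <= k < n) h k t + h n t)); last first.
  by apply/funext => t; rewrite big_nat_recr.
have [? ->] := cintegralD IH1 (hi n).
by rewrite IH2 big_nat_recr.
Qed.

End Integrals.

(** * Geometric expansion of the kernel *)

Section ImuExpansion.
Context {R : realType} {mu : {measure set R -> \bar R}}.
Local Notation D := (`[0%R, 1%R[%classic : set R).
Local Notation Dintegrable G := (mu.-integrable D (EFin \o G)).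
Implicit Types (g : R -> CC R) (z : CC R) (t : R).

Lemma in_D t : D t -> 0 <= t /\ t < 1.
Proof. by rewrite /= in_itv/= => /andP. Qed.

(** By the reverse triangle inequality; it makes [(1 - t)^-1] a majorant of the kernel uniformly on
    the closed disc. *)
Lemma norm_kernel_ge z t : `|z| <= 1 -> D t -> (1 - t)%:C <= `|1 - t%:C * z|.
Proof.
move=> z1 /in_D[t0 t1].
rewrite (le_trans _ (lerB_dist _ _))// normr1 normrM normcR.
by rewrite rmorphB rmorph1 lerB// (ger0_norm t0) ler_piMr// ler0c.
Qed.

Lemma kernel_neq0 z t : `|z| <= 1 -> D t -> 1 - t%:C * z != 0.
Proof.
move=> z1 Dt; have [t0 t1] := in_D Dt; rewrite -normr_gt0.
by apply: lt_le_trans (norm_kernel_ge z1 Dt); rewrite ltcR subr_gt0.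
Qed.

Lemma norm_kernel_le z t : `|z| <= 1 -> D t ->
  `|(1 - t%:C * z)^-1| <= ((1 - t)^-1)%:C.
Proof.
move=> z1 Dt; have [t0 t1] := in_D Dt.
have p1 : 0 < (1 - t)%:C :> R[i] by rewrite ltcR subr_gt0.
rewrite normfV fmorphV lef_pV2//; first exact: norm_kernel_ge.
by rewrite posrE normr_gt0 kernel_neq0.
Qed.

Lemma inv1B_ge0 t : D t -> 0 <= (1 - t)^-1.
Proof. by move=> /in_D[t0 t1]; rewrite invr_ge0 subr_ge0 ltW. Qed.

Lemma inv1B_ge1 t : D t -> 1 <= (1 - t)^-1.
Proof.
move=> /in_D[t0 t1]; rewrite invf_ge1 ?subr_gt0//.
by rewrite gerBl.
Qed.

Lemma exprn_D_ge0 t n : D t -> 0 <= t ^+ n.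
Proof. by move=> /in_D[t0 t1]; exact: exprn_ge0. Qed.

Lemma exprn_D_le1 t n : D t -> t ^+ n <= 1.
Proof. by move=> /in_D[t0 t1]; rewrite exprn_ile1// ltW. Qed.

Lemma measurable_exprn_D n : measurable_fun D (fun t => t ^+ n).
Proof. by apply: measurable_funX; exact: measurable_id. Qed.

Hypothesis iK : Dintegrable (fun t => (1 - t)^-1).
Let K := Rintegral mu D (fun t => (1 - t)^-1).

Lemma integrable_scaled_kernel (M : R) : Dintegrable (fun t => M * (1 - t)^-1).
Proof. exact: (integrableZl measurable_D M iK). Qed.

Lemma integrable_exprn n : Dintegrable (fun t => t ^+ n).
Proof.
apply: (le_integrable measurable_D _ _ iK).
  by apply/measurable_EFinP; exact: measurable_exprn_D.
move=> t Dt /=; rewrite lee_fin !ger0_norm ?exprn_D_ge0 ?inv1B_ge0//.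
by rewrite (le_trans (exprn_D_le1 _ Dt))// inv1B_ge1.
Qed.

Lemma moment_ge0 n : 0 <= moment mu n.
Proof. by apply: Rintegral_ge0 => t; exact: exprn_D_ge0. Qed.

Lemma cintegrable_exprn n : cintegrable mu (fun t => (t ^+ n)%:C).
Proof.
apply: cintegrable_dominated (integrable_exprn n) _.
  apply: cmeasurable_real; exact: measurable_exprn_D.
by move=> t Dt; rewrite normcR ger0_norm ?exprn_D_ge0.
Qed.

(** The partial sums increase and are integrals of [\sum_(k < n) t ^+ k <= (1 - t)^-1]. The bound
    [2 * K] carries the factor of [norm_cintegral_le]. *)
Lemma is_cvg_series_moment : cvgn (series (moment mu)).
Proof.
apply: nondecreasing_is_cvgn.
  by apply: nondecreasing_series => n _ _; exact: moment_ge0.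
exists (2 * K) => _ [n _ <-].
have [i1] := cintegral_series n cintegrable_exprn.
under [RHS]eq_bigr do rewrite cintegral_real.
rewrite -raddf_sum => E; rewrite -lecR -/(series (moment mu) n).
rewrite (le_trans _ (@norm_cintegral_le _ _ _ _ i1 iK _))//.
  by rewrite E normcR lecR ler_norm.
move=> t Dt; have [t0 t1] := in_D Dt.
rewrite -raddf_sum normcR lecR ger0_norm; last first.
  by apply: sumr_ge0 => k _; exact: exprn_D_ge0.
have := @geometric_seriesE _ 1 t; rewrite lt_eqF// => /(_ isT)/(congr1 (fun f => f n)) /=.
rewrite /series/=; under eq_bigr do rewrite mul1r.
by move=> ->; rewrite mul1r ler_piMl ?inv1B_ge0// gerBl exprn_D_ge0.
Qed.

Context {g : R -> CC R} {M : R}.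
Hypotheses (mg : cmeasurable g) (gM : forall t, D t -> `|g t| <= M%:C).

Lemma cintegrable_exprn_mul n : cintegrable mu (fun t => (t ^+ n)%:C * g t).
Proof.
apply: (cintegrable_dominated (G := fun t => M * t ^+ n)).
- by apply: cmeasurableM => //; apply: cmeasurable_real; exact: measurable_exprn_D.
- exact: (integrableZl measurable_D M (integrable_exprn n)).
- move=> t Dt; rewrite normrM normcR mulrC rmorphM/= (ger0_norm (exprn_D_ge0 n Dt)) ler_wpM2r ?gM//.
  by rewrite ler0c exprn_D_ge0.
Qed.

Lemma norm_moment_le n :
  `|cintegral mu (fun t => (t ^+ n)%:C * g t)| <= (2 * M * moment mu n)%:C.
Proof.
rewrite /moment -mulrA -RintegralZl; [|exact: measurable_D|exact: integrable_exprn].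
apply: norm_cintegral_le; first exact: cintegrable_exprn_mul.
  exact: (integrableZl measurable_D M (integrable_exprn n)).
move=> t Dt; rewrite normrM normcR mulrC rmorphM/= (ger0_norm (exprn_D_ge0 n Dt)) ler_wpM2r ?gM//.
by rewrite ler0c exprn_D_ge0.
Qed.

(** This controls the remainder of the geometric expansion, uniformly in [n] and [z]. The case
    [n = 0] is the integrability of the integrand of [Imu]. *)
Lemma cintegrable_kernel z n : `|z| <= 1 ->
  cintegrable mu (fun t => (t ^+ n)%:C * (g t / (1 - t%:C * z))) /\
  `|cintegral mu (fun t => (t ^+ n)%:C * (g t / (1 - t%:C * z)))| <= (2 * (M * K))%:C.
Proof.
move=> z1.
have bound t : D t -> `|(t ^+ n)%:C * (g t / (1 - t%:C * z)) : CC R| <= (M * (1 - t)^-1)%:C.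
  move=> Dt; rewrite !normrM normcR (ger0_norm (exprn_D_ge0 n Dt)).
  rewrite (le_trans (ler_piMl _ _))// ?mulr_ge0// ?lecR ?exprn_D_le1//.
  by rewrite rmorphM ler_pM// ?gM// norm_kernel_le.
have i1 : cintegrable mu (fun t => (t ^+ n)%:C * (g t / (1 - t%:C * z))).
  apply: cintegrable_dominated (integrable_scaled_kernel M) bound.
  apply: cmeasurableM; first by apply: cmeasurable_real; exact: measurable_exprn_D.
  exact: (cmeasurableM mg (cmeasurable_kernel z1)).
split=> //; rewrite /K -RintegralZl//.
exact: norm_cintegral_le i1 (integrable_scaled_kernel M) bound.
Qed.

Lemma cintegral_kernel_expansion z n : `|z| <= 1 ->
  cintegral mu (fun t => g t / (1 - t%:C * z)) =
  series (fun n => cintegral mu (fun t => (t ^+ n)%:C * g t) * z ^+ n) n +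
  z ^+ n * cintegral mu (fun t => (t ^+ n)%:C * (g t / (1 - t%:C * z))).
Proof.
move=> z1.
have [i1 _] := cintegrable_kernel n z1.
have [i2 <-] := cintegralZ (z ^+ n) i1.
have i3 k := cintegralZ (z ^+ k) (cintegrable_exprn_mul k).
rewrite /series/=.
under eq_bigr => k _ do rewrite mulrC -(i3 k).2.
have [i4 <-] := cintegral_series n (fun k => (i3 k).1).
have [_ <-] := cintegralD i4 i2.
apply: eq_cintegral => t Dt.
have N0 := kernel_neq0 z1 Dt.
(* The finite geometric sum, which leaves the exact remainder [(t z)^n / (1 - t z)]. *)
have E : (1 - (t%:C * z) ^+ n) / (1 - t%:C * z) = \sum_(0 <= k < n) (t%:C * z) ^+ k.
  rewrite (_ : 1 - _ ^+ n = (1 - t%:C * z) * \sum_(i < n) (t%:C * z) ^+ i); last first.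
    by rewrite -[LHS]opprB subrX1 -mulNr opprB.
  by rewrite mulrC mulKf// big_mkord.
rewrite (eq_bigr (fun k => g t * (t%:C * z) ^+ k)); last first.
  by move=> k _; rewrite rmorphXn/= exprMn; ring.
rewrite -mulr_sumr -E rmorphXn/= exprMn; field.
exact: N0.
Qed.

Lemma series_moment_cvg z : `|z| < 1 ->
  series (fun n => cintegral mu (fun t => (t ^+ n)%:C * g t) * z ^+ n : CC R) @ \oo -->
  cintegral mu (fun t => g t / (1 - t%:C * z)).
Proof.
move=> z1; have z1' := ltW z1.
have [d d0 de] := ge0_complexE (normr_ge0 z).
have d1 : `|d| < 1 by move: z1; rewrite de ltcR ger0_norm.
apply: cvgC_le => e e0.
have := @cvg_geometric _ (2 * (M * K)) d d1 => /cvgrPdist_le/(_ e e0).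
apply: filterS => n.
rewrite (cintegral_kernel_expansion n z1') sub0r normrN /= => H.
rewrite addrAC subrr add0r normrM normrX de -rmorphXn/=.
rewrite (le_trans (ler_wpM2l _ (cintegrable_kernel n z1').2))//.
  by rewrite ler0c exprn_ge0.
by rewrite -rmorphM lecR (le_trans _ H)// mulrC ler_norm.
Qed.

End ImuExpansion.

(** * Taylor coefficients of a bounded power series *)

(** Orders that are powers of 2 are reached by iterating square roots from -1. A root with
    [w ^+ (2 ^ s) = -1] has order dividing [2 ^ s.+1] but not [2 ^ s]. *)
Lemma primitive_pow2_root_exists (C : numClosedFieldType) (s : nat) :
  exists w : C, (2 ^ s.+1).-primitive_root w.
Proof.
have [w hw] : exists w : C, w ^+ (2 ^ s) = -1.
  elim: s => [|s [w hw]]; first by exists (-1); rewrite expr1.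
  by exists (sqrtC w); rewrite expnS exprM sqrtCK.
exists w.
have w1 : w ^+ (2 ^ s.+1) = 1 by rewrite expnSr exprM hw sqrrN expr1n.
have N0 : (0 < 2 ^ s.+1)%N by rewrite expn_gt0.
have [m mp /(dvdn_pfactor _ _ (isT : prime 2))[i ]] := prim_order_exists N0 w1.
rewrite leq_eqVlt => /predU1P[-> <- //|is1 mE].
have : w ^+ (2 ^ s) = 1.
  by apply/eqP; rewrite -(prim_order_dvd mp) mE dvdn_exp2l.
by rewrite hw => /eqP; rewrite eq_sym -addr_eq0 -(natrD _ 1 1) pnatr_eq0.
Qed.

Lemma sum_prim_root_expr (C : fieldType) (N m : nat) (w : C) :
  N.-primitive_root w ->
  \sum_(j < N) w ^+ (j * m) = if (N %| m)%N then N%:R else 0.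
Proof.
move=> wN; have -> : \sum_(j < N) w ^+ (j * m) = \sum_(j < N) (w ^+ m) ^+ j.
  by apply: eq_bigr => j _; rewrite mulnC exprM.
rewrite (prim_order_dvd wN); case: eqVneq => [->|m1].
  by rewrite (eq_bigr (fun=> 1)) ?sumr_const ?card_ord// => j _; rewrite expr1n.
apply: (mulfI (_ : w ^+ m - 1 != 0)); first by rewrite subr_eq0.
by rewrite -subrX1 mulr0 exprAC (prim_expr_order wN) expr1n subrr.
Qed.

(** Discrete Fourier inversion: [w ^+ (j * (N - k))] stands for [w] to the power [- j * k] with a
    natural exponent, and orthogonality keeps only [m = k]. *)
Lemma discrete_coefficient (C : fieldType) (N k : nat) (w : C) (c : nat -> C) :
  N.-primitive_root w -> (k < N)%N ->
  \sum_(j < N) (\sum_(m < N) c m * (w ^+ j) ^+ m) * w ^+ (j * (N - k)) =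
  N%:R * c k.
Proof.
move=> wN kN.
under eq_bigr do rewrite mulr_suml.
rewrite exchange_big /=.
have E (m : 'I_N) : \sum_(j < N) c m * (w ^+ j) ^+ m * w ^+ (j * (N - k)) =
    c m * (if (m == Ordinal kN) then N%:R else 0).
  have -> : (if m == Ordinal kN then N%:R else 0) = \sum_(j < N) w ^+ (j * (m + (N - k))).
    rewrite sum_prim_root_expr//; congr (if _ then _ else _).
    have -> : (N %| m + (N - k))%N = (m + (N - k) == k + (N - k) %[mod N])%N.
      by rewrite subnKC ?modnn// ltnW.
    by rewrite eqn_modDr !modn_small.
  rewrite mulr_sumr; apply: eq_bigr => j _.
  by rewrite -mulrA -exprM -exprD mulnDr.
under eq_bigr do rewrite E.
rewrite (bigD1 (Ordinal kN))//= eqxx big1 ?addr0 1?mulrC// => m /negPf ->.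
by rewrite mulr0.
Qed.

(** A Cauchy estimate with the circle integral replaced by an average over roots of unity. *)
Lemma polynomial_coef_bound (C : numClosedFieldType) (s k : nat) (B : C) (c : nat -> C) :
  (k < 2 ^ s.+1)%N ->
  (forall x, `|x| = 1 -> `|\sum_(m < 2 ^ s.+1) c m * x ^+ m| <= B) ->
  `|c k| <= B.
Proof.
move=> kN cB; have [w wN] := primitive_pow2_root_exists C s.
have N0 : (0 < 2 ^ s.+1)%N by rewrite expn_gt0.
have w1 : `|w| = 1.
  by apply/eqP; rewrite -(pexpr_eq1 N0)// -normrX (prim_expr_order wN) normr1.
have := discrete_coefficient c wN kN => /(congr1 Num.norm).
rewrite normrM normr_nat => E.
rewrite -(ler_pM2l (_ : 0 < (2 ^ s.+1)%:R)) ?ltr0n// -E.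
rewrite (le_trans (ler_norm_sum _ _ _))//.
rewrite (@le_trans _ _ (\sum_(j < 2 ^ s.+1) B))//; last first.
  by rewrite sumr_const card_ord mulr_natl.
apply: ler_sum => j _; rewrite normrM [X in _ * X]normrX w1 expr1n mulr1.
by apply: cB; rewrite normrX w1 expr1n.
Qed.

Section CoefficientBound.
Context {R : realType}.
Implicit Types (z : CC R).

Lemma is_cvg_series_norm_coef (a : nat -> CC R) (f : CC R -> CC R) (r : R) :
  0 <= r -> r < 1 ->
  (forall z, `|z| < 1 -> series (fun n => a n * z ^+ n : CC R) @ \oo --> f z) ->
  exists2 b : nat -> R, cvgn (series b) & forall n, `|a n * r%:C ^+ n| = (b n)%:C.
Proof.
move=> r0 r1 af.
have /choice[b hb] : forall n, exists b : R, `|a n * r%:C ^+ n| = b%:C.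
  by move=> n; have [b _ ->] := ge0_complexE (normr_ge0 (a n * r%:C ^+ n)); exists b.
exists b => //.
(* Convergence at a radius [p] strictly between [r] and 1 bounds [|a n| * p ^+ n] by some [A], which
   leaves the geometric majorant [A * (r / p) ^+ n]. *)
pose p := (1 + r) / 2.
have rp : r < p by rewrite /p; lra.
have p0 : 0 < p by exact: le_lt_trans rp.
have p1 : p < 1 by rewrite /p; lra.
have [A hA] : exists A : R, forall n, `|a n * p%:C ^+ n| <= A%:C.
  have pc : `|p%:C : CC R| < 1 by rewrite normcR gtr0_norm// -[1]/(1%:C) ltcR.
  have := @cvg_series_cvg_0 _ _ (fun n => a n * p%:C ^+ n : CC R).
  move=> /(_ (cvgP _ (af _ pc))) /cvgP /cvg_seq_bounded.
  by move=> /pinfty_ex_gt0[_ /gt0_complexE[A _ ->] H]; exists A => n; exact: H.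
have A0 : 0 <= A by rewrite -ler0c (le_trans _ (hA 0%N)).
have q0 : 0 <= r / p by rewrite divr_ge0// ltW.
have q1 : `|r / p| < 1 by rewrite ger0_norm// ltr_pdivrMr// mul1r.
apply: series_le_cvg (is_cvg_geometric_series (a := A) q1) => n.
- by rewrite -ler0c -hb.
- by rewrite mulr_ge0// exprn_ge0.
rewrite -lecR -hb /= rmorphM /=.
have -> : a n * r%:C ^+ n = (a n * p%:C ^+ n) * ((r / p) ^+ n)%:C.
  rewrite rmorphXn/= -mulrA -exprMn -rmorphM/= mulrCA divff ?mulr1// gt_eqF//.
by rewrite normrM [X in _ * X]ger0_norm ?ler0c ?exprn_ge0// ler_wpM2r ?hA// ler0c exprn_ge0.
Qed.

(** On the circle of radius [r < 1] a long partial sum is within [e] of [f], so the polynomial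
    estimate gives [|a k| * r ^+ k <= M + e]. Then [e] tends to 0 and [r] to 1. *)
Lemma bounded_power_series_coef_le (a : nat -> CC R) (f : CC R -> CC R) (M : R) :
  (forall z, `|z| < 1 -> series (fun n => a n * z ^+ n : CC R) @ \oo --> f z) ->
  (forall z, `|z| < 1 -> `|f z| <= M%:C) -> forall k, `|a k| <= M%:C.
Proof.
move=> af fM k.
have [alpha alpha0 alphaE] := ge0_complexE (normr_ge0 (a k)).
have main (r : R) : 0 <= r -> r < 1 -> alpha * r ^+ k <= M.
  move=> r0 r1; apply/ler_addgt0Pr => e e0.
  have [b bcvg hb] := is_cvg_series_norm_coef r0 r1 af.
  have [n0 _ hn0] : \forall n \near \oo, `|limn (series b) - series b n| <= e.
    by move/cvgrPdist_le : bcvg; exact.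
  (* Then [2 ^ s.+1] exceeds both [n0], so the tail is at most [e], and [k], so the coefficient is
     within range. *)
  pose s := maxn n0 k; have sN : (s < 2 ^ s.+1)%N.
    by rewrite (leq_trans (ltn_expl s (isT : 1 < 2)%N))// leq_exp2l.
  have kN : (k < 2 ^ s.+1)%N by rewrite (leq_ltn_trans _ sN)// leq_maxr.
  have nN : (n0 <= 2 ^ s.+1)%N by rewrite (leq_trans _ (ltnW sN))// leq_maxl.
  rewrite -lecR (_ : (alpha * _)%:C = `|a k * r%:C ^+ k|); last first.
    by rewrite normrM alphaE normrX normcR ger0_norm// -rmorphXn/= rmorphM.
  apply: (@polynomial_coef_bound _ s k _ (fun m => a m * r%:C ^+ m)) => // x x1.
  have z1 : `|r%:C * x : CC R| < 1.
    by rewrite normrM x1 mulr1 normcR ger0_norm// -[1]/(1%:C) ltcR.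
  have := @dominated_series_tail _ (fun n => a n * (r%:C * x) ^+ n) b _ (2 ^ s.+1) _ bcvg (af _ z1).
  rewrite /series/= big_mkord => /(_ _) H.
  set S := (X in `|X| <= _).
  have -> : S = (S - f (r%:C * x)) + f (r%:C * x) by rewrite subrK.
  rewrite (le_trans (ler_normD _ _))// addrC raddfD/= lerD ?fM//.
  rewrite /S (eq_bigr (fun i : 'I_(2 ^ s.+1) => a i * (r%:C * x) ^+ i)); last first.
    by move=> i _; rewrite exprMn mulrA.
  rewrite (le_trans (H _))//.
    by move=> n; rewrite exprMn mulrA normrM hb normrX x1 expr1n mulr1.
  by rewrite lecR; exact: le_trans (ler_norm _) (hn0 _ nN).
rewrite alphaE lecR.
have lim : alpha * r ^+ k @[r --> 1^'-] --> alpha * 1 ^+ k.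
  by apply: cvgMr; apply: cvg_at_left_filter; exact: exprn_continuous.
rewrite -[alpha]mulr1 -(expr1n _ k); apply: cvgr_to_le lim _.
near=> r; apply: main; last by near: r; exact: nbhs_left_lt.
by near: r; exact: nbhs_left_ge.
Unshelve. all: by end_near. Qed.

End CoefficientBound.

(** * The operators on bounded holomorphic functions *)

Section HilbertMatrix.
Context {R : realType} {mu : {measure set R -> \bar R}}.
Local Notation D := (`[0%R, 1%R[%classic : set R).
Local Notation Dintegrable G := (mu.-integrable D (EFin \o G)).
Implicit Types (f : CC R -> CC R) (z : CC R) (t : R).

Lemma Hinf_cmeasurable f : Hinf f -> cmeasurable (fun t => f t%:C).
Proof.
move=> [fd _]; apply: cmeasurable_continuous => t t1.
apply: (@continuous_comp _ _ _ (fun t : R => t%:C : CC R) f).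
  exact: continuous_real_complex.
apply: differentiable_continuous; apply/derivable1_diffP/fd.
by rewrite normcR -[1]/(1%:C) ltcR.
Qed.

Lemma norm_D_lt1 t : D t -> `|t%:C : CC R| < 1.
Proof. by move=> /in_D[t0 t1]; rewrite normcR ger0_norm// -[1]/(1%:C) ltcR. Qed.

Hypothesis iK : Dintegrable (fun t => (1 - t)^-1).

Lemma integrable_exprn_kernel n : Dintegrable (fun t => t ^+ n * (1 - t)^-1).
Proof.
apply: (le_integrable measurable_D _ _ iK).
  apply/measurable_EFinP; apply: measurable_funM; first exact: measurable_exprn_D.
  exact: measurable_inv1B.
move=> t Dt /=; rewrite lee_fin normrM ler_piMl// ger0_norm ?exprn_D_ge0//.
exact: exprn_D_le1.
Qed.

Lemma cvg_integral_exprn_kernel :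
  Rintegral mu D (fun t => t ^+ n * (1 - t)^-1) @[n --> \oo] --> 0.
Proof.
apply: fine_cvg.
have [] := @dominated_convergence _ _ _ mu D measurable_D
  (fun n t => (t ^+ n * (1 - t)^-1)%:E) (cst 0%E) (EFin \o (fun t => (1 - t)^-1)).
- by move=> n; have /integrableP[] := integrable_exprn_kernel n.
- exact: measurable_cst.
- apply/aeW => t /in_D[t0 t1]; apply: cvg_EFin; first exact: nearW.
  rewrite (_ : fine \o _ = fun n => t ^+ n * (1 - t)^-1)//= -(mul0r (1 - t)^-1).
  by apply: cvgMl; apply: cvg_expr; rewrite ger0_norm.
- exact: iK.
- apply/aeW => t n Dt /=; rewrite lee_fin ger0_norm ?mulr_ge0 ?exprn_D_ge0 ?inv1B_ge0//.
  by rewrite ler_piMl ?inv1B_ge0// exprn_D_le1.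
by move=> _ _; rewrite integral0.
Qed.

(** The [N]-th partial sum is the integral of [t ^+ n] times the Taylor polynomial of [f] at [t].
    Its distance to the limit is governed by [cvg_integral_exprn_kernel]. *)
Lemma series_moment_coef_cvg f (a : nat -> CC R) (A : R) n : Hinf f ->
  (forall z, `|z| < 1 -> series (fun n => (a n * z ^+ n : CC R)) @ \oo --> f z) ->
  (forall k, `|a k| <= A%:C) ->
  series (fun k => ((moment mu (n + k))%:C * a k : CC R)) @ \oo -->
  cintegral mu (fun t => (t ^+ n)%:C * f t%:C).
Proof.
move=> fH af aA; have [_ [M fM]] := fH.
have mf := Hinf_cmeasurable fH.
have A0 : 0 <= A by rewrite -ler0c (le_trans _ (aA 0%N)).
have i1 := cintegrable_exprn_mul iK mf (fun t Dt => fM _ (norm_D_lt1 Dt)) n.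
have i2 k := cintegralZ (a k) (cintegrable_exprn iK (n + k)).
have i3 N := cintegral_series N (fun k => (i2 k).1).
have i4 N := cintegralZ (-1) (i3 N).1.
have i5 N := cintegralD i1 (i4 N).1.
have bound N t : D t -> `|(t ^+ n)%:C * f t%:C + -1 * \sum_(0 <= k < N) a k * (t ^+ (n + k))%:C|
    <= (A * (t ^+ N * (1 - t)^-1))%:C.
  move=> Dt; have [t0 t1] := in_D Dt.
  have tn : `|t| < 1 by rewrite ger0_norm.
  (* The Taylor remainder at [t] is dominated by the geometric tail [A * t ^+ N / (1 - t)], and the
     factor [t ^+ n] is at most 1. *)
  have bcvg : series (geometric A t) @ \oo --> A * (1 - t)^-1 by exact: cvg_geometric_series.
  have ab k : `|a k * t%:C ^+ k : CC R| <= (geometric A t k)%:C.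
    rewrite normrM normrX normcR (ger0_norm t0) /= rmorphM rmorphXn ler_wpM2r//.
    by rewrite exprn_ge0// ler0c.
  have := dominated_series_tail N ab (cvgP _ bcvg) (af _ (norm_D_lt1 Dt)).
  rewrite (cvg_lim _ bcvg)// geometric_seriesE ?lt_eqF//= distrC => H.
  rewrite (_ : _ + _ = (t ^+ n)%:C * (f t%:C - series (fun k => a k * t%:C ^+ k) N)); last first.
    rewrite mulrBr mulN1r; congr (_ - _); rewrite /series/= mulr_sumr.
    by apply: eq_bigr => k _; rewrite exprD !rmorphM !rmorphXn/=; ring.
  rewrite normrM normcR (ger0_norm (exprn_D_ge0 n Dt)).
  rewrite (le_trans (ler_piMl _ _))//; first by rewrite lecR exprn_D_le1.
  rewrite (le_trans H)// lecR le_eqVlt; apply/orP; left; apply/eqP.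
  by field; rewrite subr_eq0 gt_eqF.
have iA N := integrableZl measurable_D A (integrable_exprn_kernel N).
have diff N : `|cintegral mu (fun t => (t ^+ n)%:C * f t%:C) -
    series (fun k => ((moment mu (n + k))%:C * a k : CC R)) N| <=
    (2 * (A * Rintegral mu D (fun t => t ^+ N * (1 - t)^-1)))%:C.
  rewrite (_ : series _ N =
    cintegral mu (fun t => \sum_(0 <= k < N) a k * (t ^+ (n + k))%:C)); last first.
    rewrite (i3 N).2; apply: eq_bigr => k _.
    by rewrite (i2 k).2 cintegral_real mulrC.
  rewrite -mulN1r -(i4 N).2 -(i5 N).2 -RintegralZl//; last exact: integrable_exprn_kernel.
  apply: norm_cintegral_le (i5 N).1 (iA N) (bound N).
apply: cvgC_le => e e0.
have : 2 * (A * Rintegral mu D (fun t => t ^+ N * (1 - t)^-1)) @[N --> \oo] --> 2 * (A * 0).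
  by apply: cvgMr; apply: cvgMr; exact: cvg_integral_exprn_kernel.
rewrite !mulr0 => /cvgrPdist_le/(_ e e0); apply: filterS => N.
rewrite sub0r normrN => H; rewrite (le_trans (diff N))// lecR.
exact: le_trans (ler_norm _) H.
Qed.

(** The Taylor coefficients of [Imu mu f]; by [series_moment_coef_cvg] they are also the values of
    [Hmu_coef]. *)
Definition Imu_coef (mu : {measure set R -> \bar R}) f n : CC R :=
  cintegral mu (fun t => (t ^+ n)%:C * f t%:C).

Lemma Imu_power_series f z : Hinf f -> `|z| < 1 ->
  series (fun n => Imu_coef mu f n * z ^+ n : CC R) @ \oo --> Imu mu f z.
Proof.
move=> fH z1; have [_ [M fM]] := fH.
exact: (series_moment_cvg iK (Hinf_cmeasurable fH) (fun t Dt => fM _ (norm_D_lt1 Dt)) z1).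
Qed.

Lemma norm_Imu_coef_le f M n : Hinf f -> (forall z, `|z| < 1 -> `|f z| <= M%:C) ->
  `|Imu_coef mu f n| <= (2 * M * moment mu n)%:C.
Proof.
move=> fH fM.
exact: (norm_moment_le iK (Hinf_cmeasurable fH) (fun t Dt => fM _ (norm_D_lt1 Dt))).
Qed.

Lemma is_cvg_series_moment_scale (k : R) : cvgn (series (fun n => k * moment mu n)).
Proof.
rewrite (_ : series _ = fun n => k * series (moment mu) n).
  by apply: is_cvgMr; exact: is_cvg_series_moment.
by apply/funext => n; rewrite /series/= mulr_sumr.
Qed.

Lemma Imu_cintegrable f z : Hinf f -> `|z| < 1 -> cintegrable mu (Imu_integrand f z).
Proof.
move=> fH z1; have [_ [M fM]] := fH.
have [+ _] := cintegrable_kernel iK (Hinf_cmeasurable fH)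
  (fun t Dt => fM _ (norm_D_lt1 Dt)) 0 (ltW z1).
by congr cintegrable; apply/funext => t; rewrite expr0 mul1r.
Qed.

Lemma Imu_Hinf f : Hinf f -> Hinf (Imu mu f).
Proof.
move=> fH; have [_ [M fM]] := fH.
apply: (power_series_Hinf (c := Imu_coef mu f) _ (@is_cvg_series_moment_scale (2 * M))).
- by move=> n; exact: norm_Imu_coef_le fH fM.
- by move=> z; exact: Imu_power_series.
Qed.

(** The majorant [2 * M * moment mu n] is common to all the images [Imu mu (f k)]. *)
Lemma Imu_compact : compact_op_Hinf (Imu mu).
Proof.
move=> f fH [M fM].
apply: (power_series_uniform_subsequence (c := fun k => Imu_coef mu (f k))
  (F := fun k => Imu mu (f k)) _
  (@is_cvg_series_moment_scale (2 * M))).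
- by move=> k n; exact: norm_Imu_coef_le (fH k) (fM k).
- by move=> k z; exact: Imu_power_series.
Qed.

End HilbertMatrix.

Unset Implicit Arguments.
Theorem theorem25 (R : realType) (mu : {measure set R -> \bar R}) :
  finite_measure_on_01 mu ->
  (\int[mu]_(t in `[0%R, 1%R[) ((1 - t)^-1)%:E < +oo)%E ->
  (* I_mu maps H^infty into H^infty (the defining integral exists) *)
  (forall f : CC R -> CC R, Hinf f ->
     (forall z : CC R, `|z| < 1 -> cintegrable mu (Imu_integrand f z)) /\
     Hinf (Imu mu f)) /\
  (* I_mu : H^infty -> H^infty is compact *)
  compact_op_Hinf (Imu mu) /\
  (* H_mu = I_mu on H^infty *)
  (forall (f : CC R -> CC R) (a : nat -> CC R), Hinf f ->
     (forall z : CC R, `|z| < 1 -> series (fun n => (a n * z ^+ n : CC R)) @ \oo --> f z) ->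
     (forall n, cvg (series (fun k => ((moment mu (n + k))%:C * a k : CC R)) @ \oo)) /\
     (forall z : CC R, `|z| < 1 ->
        series (fun n => (Hmu_coef mu a n * z ^+ n : CC R)) @ \oo --> Imu mu f z)).
Proof.
move=> _ Ky.
have iK : mu.-integrable `[0%R, 1%R[ (EFin \o (fun t => (1 - t)^-1)).
  apply/integrableP; split; first by apply/measurable_EFinP; exact: measurable_inv1B.
  move: Ky; congr (_ < _)%E; apply: eq_integral => t; rewrite inE => Dt /=.
  by rewrite ger0_norm// inv1B_ge0.
split; first by move=> f fH; split; [move=> z; exact: Imu_cintegrable|exact: Imu_Hinf].
split; first exact: Imu_compact.
move=> f a fH af; have [_ [M fM]] := fH.
(* The sup bound of [f] serves as the coefficient bound [A] of [series_moment_coef_cvg]. *)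
have aM := bounded_power_series_coef_le af fM.
have coef n := @series_moment_coef_cvg _ _ iK f a M n fH af aM.
split=> [n|z z1]; first exact: cvgP (coef n).
(* The two operators have the same Taylor coefficients, so the expansion of [Imu mu f] concludes. *)
rewrite (_ : (fun n => _) = (fun n => Imu_coef mu f n * z ^+ n)); last first.
  by apply/funext => n; rewrite /Hmu_coef (cvg_lim _ (coef n)).
exact: Imu_power_series.
Qed.
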